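(* Let $\mathbb{F}$ be an algebraically closed field with $\operatorname{char}\mathbb{F}\neq 2$, let $n\geq 2$, and let $Q=Q(n)=Q^{\bar 0}\oplus Q^{\bar 1}$ be either the simple Lie superalgebra $Q(n)$ over $\mathbb{F}$ (in which case assume in addition that $\operatorname{char}\mathbb{F}$ does not divide $n+1$) or the simple Jordan superalgebra $Q(n)$ over $\mathbb{F}$. Let $G$ be an abelian group, let $\Gamma$ and $\Delta$ be $G$-gradings on the algebra $Q^{\bar 0}$, and let $c,d\in G$ be such that $\Gamma\oplus\underline{\Gamma}^{[c]}$ and $\Delta\oplus\underline{\Delta}^{[d]}$ are $G$-gradings on the superalgebra $Q$. Then $\Gamma\oplus\underline{\Gamma}^{[c]}$ and $\Delta\oplus\underline{\Delta}^{[d]}$ are isomorphic if and only if $\Gamma$ and $\Delta$ are isomorphic and $c=d$.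
   Context: Groups are written multiplicatively with identity $e$. All spaces are finite-dimensional over $\mathbb{F}$. **The superalgebras.** $M_k$ is the algebra of $k\times k$ matrices over $\mathbb{F}$. For $A_k=M_k\oplus uM_k$, the associative superalgebra with even part $M_k$ and odd part $uM_k$, where $u$ is odd, commutes with $M_k$ and $u^2=1$: - Lie case: $Q(n)$ is the quotient by its center $\mathbb{F}1$ of the derived superalgebra of $A_{n+1}$ under the supercommutator $[x,y]=xy-(-1)^{ij}yx$ ($x$ of parity $i$, $y$ of parity $j$). When $\operatorname{char}\mathbb{F}\nmid n+1$, put $a^\sharp=a-\frac{1}{n+1}\operatorname{tr}(a)1$; then $Q(n)$ is identified (via $a+ub+\mathbb{F}1\mapsto(a^\sharp,b)$) with $\mathfrak{sl}(n+1)\oplus\mathfrak{sl}(n+1)$ (even part $\oplus$ odd part). Writing $x$ for $(x,0)$ and $\underline{x}$ for $(0,x)$, the bracket is $[a,b]=ab-ba$, $[a,\underline{b}]=\underline{ab-ba}$, $[\underline{a},\underline{b}]=(ab+ba)^\sharp$ (and $[\underline b,a]=-[a,\underline b]$). So $Q^{\bar 0}=\mathfrak{sl}(n+1)$. - Jordan case: $Q(n)$ is $A_n$ with the product $x\circ y=xy+(-1)^{ij}yx$. It is identified with $M_n\oplus M_n$ via $a+ub\mapsto(a,b)$; writing $x$ for $(x,0)$ and $\underline{x}$ for $(0,x)$, the product is $a\circ b=ab+ba$, $a\circ\underline{b}=\underline{b}\circ a=\underline{ab+ba}$, $\underline{a}\circ\underline{b}=ab-ba$. So $Q^{\bar 0}=M_n^{(+)}$,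 the Jordan algebra $M_n$ with product $ab+ba$. In both cases $x\mapsto\underline{x}$ is an isomorphism of $Q^{\bar 0}$-modules $Q^{\bar 0}\to Q^{\bar 1}$. **Gradings.** A $G$-grading on a superalgebra $A$ is a vector space decomposition $A=\bigoplus_{g\in G}A_g$ with $A_gA_k\subseteq A_{gk}$ and $A_g=(A_g\cap A^{\bar 0})\oplus(A_g\cap A^{\bar 1})$ for all $g,k\in G$. For ordinary algebras (zero odd part) the second condition is vacuous. Homomorphisms of superalgebras preserve parity. Two $G$-gradings $A=\bigoplus_g A_g$ and $B=\bigoplus_g B_g$ are isomorphic if there is an isomorphism of (super)algebras $\varphi:A\to B$ with $\varphi(A_g)=B_g$ for all $g\in G$. **Notation.** For a $G$-grading $\Gamma:V=\bigoplus_g V_g$ on a vector space and $d\in G$, the shift $\Gamma^{[d]}$ is the $G$-grading obtained by relabeling the component $V_g$ as $V_{gd}$ for all $g$. For a $G$-grading $\Gamma$ on $Q^{\bar 0}$, $\underline{\Gamma}$ is the $G$-grading on the vector space $Q^{\bar 1}$ with components $\{\underline{x}\mid x\in Q^{\bar 0}_g\}$. For $G$-gradings $\Gamma$ on $V=Q^{\bar 0}$ and $\Delta$ on $W=Q^{\bar 1}$, $\Gamma\oplus\Delta$ is the decomposition of $V\oplus W$ with components $V_g\oplus W_g$. *)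

(* Defs.v *)
From HB Require Import structures.
From mathcomp Require Import all_boot all_order all_algebra.

Set Implicit Arguments.
Unset Strict Implicit.
Unset Printing Implicit Defensive.

Import GRing.Theory.
Local Open Scope ring_scope.

(* Parities are booleans: false is even, true is odd, and (+) is their sum.   *)
(* No identity (associativity, Jacobi, Jordan, ...) is imposed on the         *)
(* product; an ordinary algebra is a superalgebra with zero odd part.         *)
Record superalg (F : fieldType) := Superalg {
  sa_space :> vectType F;
  sa_part : bool -> {vspace sa_space};
  sa_mul : sa_space -> sa_space -> sa_space;
  sa_partD : (sa_part false + sa_part true = fullv)%VS;
  sa_partI : (sa_part false :&: sa_part true = 0)%VS;
  sa_mul_linearl : forall y, linear (sa_mul^~ y);
  sa_mul_linearr : forall x, linear (sa_mul x);
  sa_mul_part : forall i j x y, x \in sa_part i -> y \in sa_part j ->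
    sa_mul x y \in sa_part (i (+) j)
}.

Section Gradings.
Variables (F : fieldType) (G : groupType).

(* G may be infinite, so the direct sum condition is stated on finite lists   *)
(* of distinct degrees.                                                       *)
Definition decomposition (V : vectType F) (Gam : G -> {vspace V}) :=
  (forall s : seq G, uniq s -> directv (\sum_(g <- s) Gam g)) /\
  (exists2 s : seq G, uniq s & (\sum_(g <- s) Gam g = fullv)%VS).

Definition is_grading (A : superalg F) (Gam : G -> {vspace A}) :=
  [/\ decomposition Gam,
      forall (g h : G) (x y : A), x \in Gam g -> y \in Gam h ->
        sa_mul x y \in Gam (g * h)%g
    & forall g : G, Gam g = ((Gam g :&: sa_part A false)
                             + (Gam g :&: sa_part A true))%VS].

Definition is_iso (A B : superalg F) (phi : 'Hom(A, B)) :=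
  [/\ lker phi = 0%VS,
      limg phi = fullv,
      forall x y : A, phi (sa_mul x y) = sa_mul (phi x) (phi y)
    & forall i : bool, (phi @: sa_part A i <= sa_part B i)%VS].

Definition isomorphic_gradings (A B : superalg F)
    (Gam : G -> {vspace A}) (Del : G -> {vspace B}) :=
  exists2 phi : 'Hom(A, B), is_iso phi & forall g, (phi @: Gam g = Del g)%VS.

(* The component V_g is relabelled V_(g d). *)
Definition shift (V : vectType F) (Gam : G -> {vspace V}) (d : G) :
    G -> {vspace V} :=
  fun g => Gam (g * d^-1)%g.

Definition oplus (V : vectType F) (Gam Del : G -> {vspace V}) :
    G -> {vspace V} :=
  fun g => (Gam g + Del g)%VS.

End Gradings.

Arguments is_grading {F G} A Gam.
Arguments isomorphic_gradings {F G} A B Gam Del.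

Section Doubles.
Variable F : fieldType.

Definition evenc (V : vectType F) (x : V) : (V * V)%type := (x, 0).
Definition oddc (V : vectType F) (x : V) : (V * V)%type := (0, x).

Fact evenc_linear (V : vectType F) : linear (@evenc V).
Proof. by move=> a x y; congr (_, _); rewrite /= scaler0 addr0. Qed.
HB.instance Definition _ (V : vectType F) :=
  GRing.isLinear.Build F V (V * V)%type _ (@evenc V) (@evenc_linear V).

Fact oddc_linear (V : vectType F) : linear (@oddc V).
Proof. by move=> a x y; congr (_, _); rewrite /= scaler0 addr0. Qed.
HB.instance Definition _ (V : vectType F) :=
  GRing.isLinear.Build F V (V * V)%type _ (@oddc V) (@oddc_linear V).

Definition embc (V : vectType F) (i : bool) : 'Hom(V, (V * V)%type) :=
  linfun (if i then @oddc V else @evenc V).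

Lemma embcE (V : vectType F) i (x : V) :
  embc V i x = if i then (0, x) else (x, 0).
Proof. by case: i; rewrite lfunE. Qed.

Definition part (V : vectType F) (i : bool) (x : V * V) : V * V :=
  if i then (0, x.2) else (x.1, 0).

Lemma part_linear (V : vectType F) i : linear (@part V i).
Proof. by case: i => a x y; congr (_, _); rewrite /= scaler0 addr0. Qed.

Lemma partD (V : vectType F) (x : V * V) : part false x + part true x = x.
Proof. by case: x => a b; congr (_, _); rewrite /= (addr0, add0r). Qed.

Lemma mem_limg_embc (V : vectType F) i (x : V * V) :
  (x \in limg (embc V i)) = (part i x == x).
Proof.
apply/idP/eqP => [/memv_imgP[a _ ->]|<-]; first by rewrite embcE; case: i.
apply/memv_imgP; exists (if i then x.2 else x.1); first exact: memvf.
by rewrite embcE; case: i.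
Qed.

(* A superalgebra whose even and odd parts are both copies of a space V, with *)
(* (x, 0) the even copy of x and (0, x) the odd one.                          *)
Record dblalg := Dblalg {
  dbl_space : vectType F;
  dbl_mul : dbl_space * dbl_space -> dbl_space * dbl_space ->
    dbl_space * dbl_space;
  dbl_mul_linearl : forall y, linear (dbl_mul^~ y);
  dbl_mul_linearr : forall x, linear (dbl_mul x);
  dbl_mul_part : forall i j x y,
    part (i (+) j) (dbl_mul (part i x) (part j y)) =
    dbl_mul (part i x) (part j y)
}.

Section OneDouble.
Variable D : dblalg.
Local Notation V := (dbl_space D).

Definition dbl_part (i : bool) : {vspace (V * V)%type} := limg (embc V i).

Fact dbl_partD : (dbl_part false + dbl_part true = fullv)%VS.
Proof.
apply/eqP; rewrite eqEsubv subvf; apply/subvP=> x _; rewrite -(partD x).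
by apply: memv_add; rewrite mem_limg_embc.
Qed.

Fact dbl_partI : (dbl_part false :&: dbl_part true = 0)%VS.
Proof.
apply/eqP; rewrite -subv0; apply/subvP=> -[a b].
rewrite memv_cap !mem_limg_embc memv0 => /andP[/eqP[<-] /eqP[<-]].
by [].
Qed.

Fact dbl_part_mul i j x y : x \in dbl_part i -> y \in dbl_part j ->
  dbl_mul x y \in dbl_part (i (+) j).
Proof.
rewrite !mem_limg_embc => /eqP<- /eqP<-; exact/eqP/dbl_mul_part.
Qed.

Definition dbl_super : superalg F :=
  @Superalg F (V * V)%type dbl_part (@dbl_mul D) dbl_partD dbl_partI
    (@dbl_mul_linearl D) (@dbl_mul_linearr D) dbl_part_mul.

Definition even_mul (x y : V) : V := (dbl_mul (evenc x) (evenc y)).1.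

Lemma even_mulE x y : evenc (even_mul x y) = dbl_mul (evenc x) (evenc y).
Proof. exact: (@dbl_mul_part D false false (evenc x) (evenc y)). Qed.

Fact even_mul_linearl y : linear (even_mul^~ y).
Proof. by move=> a u v; rewrite /even_mul linearP dbl_mul_linearl. Qed.

Fact even_mul_linearr x : linear (even_mul x).
Proof. by move=> a u v; rewrite /even_mul linearP dbl_mul_linearr. Qed.

Definition even_part (i : bool) : {vspace V} := if i then 0%VS else fullv.

Fact even_partD : (even_part false + even_part true = fullv)%VS.
Proof. exact: addv0. Qed.

Fact even_partI : (even_part false :&: even_part true = 0)%VS.
Proof. exact: capv0. Qed.

Fact even_part_mul i j x y : x \in even_part i -> y \in even_part j ->
  even_mul x y \in even_part (i (+) j).
Proof.
have mul0x z : even_mul 0 z = 0.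
  by have /= := even_mul_linearl z (-1) 0 0; rewrite scaler0 addr0 scaleN1r addNr.
have mulx0 z : even_mul z 0 = 0.
  by have /= := even_mul_linearr z (-1) 0 0; rewrite scaler0 addr0 scaleN1r addNr.
case: i j => [] [] /=; rewrite ?memvf // !memv0.
- by move=> /eqP-> _; rewrite mul0x.
- by move=> _ /eqP->; rewrite mulx0.
Qed.

Definition dbl_even : superalg F :=
  @Superalg F V even_part even_mul even_partD even_partI
    even_mul_linearl even_mul_linearr even_part_mul.

End OneDouble.

(* e = -1 gives the supercommutator, e = 1 the Jordan superproduct.           *)
Section SuperProduct.
Variables (e : F) (D : dblalg).
Local Notation V := (dbl_space D).

Definition super_mul (x y : V * V) : V * V :=
  \sum_(i : bool) \sum_(j : bool)
    (dbl_mul (part i x) (part j y)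
     + (e * (-1) ^+ (i && j)) *: dbl_mul (part j y) (part i x)).

Fact super_mul_linearl y : linear (super_mul^~ y).
Proof.
move=> a u v; rewrite /super_mul scaler_sumr -big_split; apply: eq_bigr => i _.
rewrite scaler_sumr -big_split; apply: eq_bigr => j _ /=.
rewrite part_linear dbl_mul_linearl dbl_mul_linearr !scalerDr !scalerA.
by rewrite [_ * a]mulrC addrACA.
Qed.

Fact super_mul_linearr x : linear (super_mul x).
Proof.
move=> a u v; rewrite /super_mul scaler_sumr -big_split; apply: eq_bigr => i _.
rewrite scaler_sumr -big_split; apply: eq_bigr => j _ /=.
rewrite part_linear dbl_mul_linearl dbl_mul_linearr !scalerDr !scalerA.
by rewrite [_ * a]mulrC addrACA.
Qed.

Lemma dbl_mul0x (z : V * V) : dbl_mul 0 z = 0.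
Proof.
have /= := dbl_mul_linearl z (-1) 0 0.
by rewrite scaler0 addr0 scaleN1r addNr.
Qed.

Lemma dbl_mulx0 (z : V * V) : dbl_mul z 0 = 0.
Proof.
have /= := dbl_mul_linearr z (-1) 0 0.
by rewrite scaler0 addr0 scaleN1r addNr.
Qed.

Lemma super_mul_homogeneous i j (x y : V * V) :
  super_mul (part i x) (part j y) =
  dbl_mul (part i x) (part j y)
  + (e * (-1) ^+ (i && j)) *: dbl_mul (part j y) (part i x).
Proof.
have partK k l (z : V * V) : part k (part l z) = if k == l then part l z else 0.
  by case: k l => [] [].
rewrite /super_mul !big_bool !partK.
by case: i j => [] []; rewrite /= !(dbl_mul0x, dbl_mulx0, scaler0, addr0, add0r).
Qed.

Fact super_mul_part i j x y :
  part (i (+) j) (super_mul (part i x) (part j y)) =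
  super_mul (part i x) (part j y).
Proof.
rewrite super_mul_homogeneous [X in part _ X]addrC part_linear.
by rewrite dbl_mul_part {1}addbC dbl_mul_part addrC.
Qed.

Definition super_dbl : dblalg :=
  Dblalg super_mul_linearl super_mul_linearr super_mul_part.

End SuperProduct.

Section AssociativeQ.
Variable k : nat.
Local Notation M := 'M[F]_k.

(* (a, b) stands for a + u b. *)
Definition assoc_mul (x y : M * M) : M * M :=
  (x.1 *m y.1 + x.2 *m y.2, x.1 *m y.2 + x.2 *m y.1).

Fact assoc_mul_linearl y : linear (assoc_mul^~ y).
Proof.
move=> a u v; congr (_, _);
by rewrite /= !mulmxDl -!scalemxAl scalerDr addrACA.
Qed.

Fact assoc_mul_linearr x : linear (assoc_mul x).
Proof.
move=> a u v; congr (_, _);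
by rewrite /= !mulmxDr -!scalemxAr scalerDr addrACA.
Qed.

Fact assoc_mul_part i j x y :
  part (i (+) j) (assoc_mul (part i x) (part j y)) =
  assoc_mul (part i x) (part j y).
Proof.
by case: i j => [] []; rewrite /assoc_mul /= !(mul0mx, mulmx0) ?addr0 ?add0r.
Qed.

Definition assoc_dbl : dblalg :=
  @Dblalg M assoc_mul assoc_mul_linearl assoc_mul_linearr assoc_mul_part.

End AssociativeQ.

Definition jordanQ (n : nat) : dblalg := super_dbl 1 (assoc_dbl n).

Lemma super_assocE (e : F) k (a b a' b' : 'M[F]_k) :
  @super_mul e (assoc_dbl k) (a, b) (a', b') =
  ((a *m a' + e *: (a' *m a)) + (b *m b' - e *: (b' *m b)),
   (a *m b' + e *: (b' *m a)) + (b *m a' + e *: (a' *m b))).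
Proof.
rewrite /super_mul !big_bool /= /assoc_mul /= !(mul0mx, mulmx0, addr0, add0r).
rewrite expr0 expr1 !mulr1 mulrN1 scaleNr; congr (_, _);
by rewrite /= !(scaler0, addr0, add0r, oppr0) addrC.
Qed.

Lemma jordanQE n (a b a' b' : 'M[F]_n) :
  @dbl_mul (jordanQ n) (a, b) (a', b') =
  ((a *m a' + a' *m a) + (b *m b' - b' *m b),
   (a *m b' + b' *m a) + (b *m a' + a' *m b)).
Proof. by rewrite /= super_assocE !scale1r. Qed.

Section LieQ.
Variable k : nat.
Local Notation M := 'M[F]_k.

Definition sl : {vspace M} := lker (linfun (mxtrace : M -> F^o)).

Lemma mem_sl a : (a \in sl) = (\tr a == 0).
Proof. by rewrite memv_ker lfunE. Qed.

Definition sharp (a : M) : M := a - (k%:R^-1 * \tr a)%:M.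

Fact sharp_linear : linear sharp.
Proof.
move=> c a b; rewrite /sharp linearP /= scalerBr scale_scalar_mx.
rewrite mulrDr mulrCA raddfD /= opprD addrACA.
by [].
Qed.

Lemma sharp_sl a : k%:R != 0 :> F -> sharp a \in sl.
Proof.
move=> k0; rewrite mem_sl /sharp raddfB /= mxtrace_scalar.
by rewrite -mulrnAl -[X in X * _]mulr_natr mulVf // mul1r subrr.
Qed.

Definition subQ (x : subvs_of sl * subvs_of sl) : M * M :=
  (vsval x.1, vsval x.2).

(* a + u b + F1 |-> (sharp a, b); the derived superalgebra of M_k + u M_k     *)
(* under the supercommutator consists of the a + u b with tr b = 0.           *)
Definition toQ (x : M * M) : subvs_of sl * subvs_of sl :=
  (vsproj sl (sharp x.1), vsproj sl x.2).

Definition lie_mul (x y : subvs_of sl * subvs_of sl) :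
    subvs_of sl * subvs_of sl :=
  toQ (@super_mul (-1) (assoc_dbl k) (subQ x) (subQ y)).

Fact subQ_linear : linear subQ.
Proof. by move=> a x y; congr (_, _); rewrite /= linearP. Qed.

Fact toQ_linear : linear toQ.
Proof. by move=> a u v; congr (_, _); rewrite /= ?sharp_linear linearP. Qed.

Fact lie_mul_linearl y : linear (lie_mul^~ y).
Proof.
move=> a u v; rewrite /lie_mul subQ_linear.
by rewrite (@super_mul_linearl (-1) (assoc_dbl k)) toQ_linear.
Qed.

Fact lie_mul_linearr x : linear (lie_mul x).
Proof.
move=> a u v; rewrite /lie_mul subQ_linear.
by rewrite (@super_mul_linearr (-1) (assoc_dbl k)) toQ_linear.
Qed.

Fact lie_mul_part i j x y :
  part (i (+) j) (lie_mul (part i x) (part j y)) =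
  lie_mul (part i x) (part j y).
Proof.
have subQ_part l z : subQ (part l z) = part l (subQ z).
  by case: l; congr (_, _).
have toQ_part l z : part l (toQ z) = toQ (part l z).
  by case: l; rewrite /toQ /= ?(raddf0, linear0) // /sharp mxtrace0 mulr0 raddf0
    subr0 linear0.
by rewrite /lie_mul !subQ_part toQ_part (@super_mul_part (-1) (assoc_dbl k)).
Qed.

Definition lie_dbl : dblalg :=
  @Dblalg (subvs_of sl) lie_mul lie_mul_linearl lie_mul_linearr lie_mul_part.

Lemma sharp_id a : a \in sl -> sharp a = a.
Proof.
by rewrite mem_sl /sharp => /eqP->; rewrite mulr0 raddf0 subr0.
Qed.

Lemma subQK : cancel subQ toQ.
Proof.
by case=> a b; rewrite /toQ /= sharp_id ?subvsP // !vsvalK.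
Qed.

Hypothesis k_neq0 : k%:R != 0 :> F.

Lemma lie_mulE (x y : subvs_of sl * subvs_of sl) :
  let a := vsval x.1 in let b := vsval x.2 in
  let a' := vsval y.1 in let b' := vsval y.2 in
  subQ (lie_mul x y) =
  ((a *m a' - a' *m a) + sharp (b *m b' + b' *m b),
   (a *m b' - b' *m a) + (b *m a' - a' *m b)).
Proof.
have comm_sl u v : u *m v - v *m u \in sl.
  by rewrite mem_sl raddfB /= mxtrace_mulC subrr.
rewrite /lie_mul /toQ super_assocE /subQ /= !scaleN1r opprK.
rewrite !vsprojK ?sharp_sl //; last exact: memvD.
congr pair; move: (comm_sl (vsval x.1) (vsval y.1)).
move: (_ - _) => u u_sl; move: (_ *m _ + _ *m _) => v.
by have := sharp_linear 1 u v; rewrite !scale1r => ->; rewrite sharp_id.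
Qed.

Lemma toQ_ker (x : M * M) : \tr x.2 = 0 ->
  toQ x = 0 <-> exists c : F, x = (c%:M, 0).
Proof.
case: x => a b /= trb; split=> [[/(congr1 val) /= + /(congr1 val) /=]|[c [-> ->]]].
  rewrite !vsprojK ?sharp_sl // ?mem_sl ?trb // => /eqP.
  by rewrite subr_eq0 => /eqP-> ->; eexists.
rewrite /toQ /sharp /= mxtrace_scalar -[c *+ k]mulr_natr mulrCA mulVf // mulr1.
by rewrite subrr !linear0.
Qed.

Lemma toQ_morph (x y : M * M) : \tr x.2 = 0 -> \tr y.2 = 0 ->
  toQ (@super_mul (-1) (assoc_dbl k) x y) = lie_mul (toQ x) (toQ y).
Proof.
have dec u : \tr u.2 = 0 -> exists c : F, u = c *: (1%:M, 0) + subQ (toQ u).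
  case: u => a b /= trb; exists (k%:R^-1 * \tr a).
  rewrite /toQ /subQ /= !vsprojK ?sharp_sl // ?mem_sl ?trb //.
  by congr (_, _); rewrite /= ?scale_scalar_mx ?scaler0 ?add0r // mulr1 addrC subrK.
have s1x u : @super_mul (-1) (assoc_dbl k) (1%:M, 0) u = 0.
  case: u => a b; rewrite super_assocE !(mul0mx, mulmx0, mul1mx, mulmx1).
  by rewrite !(scaleN1r, subrr, oppr0, addr0).
have sx1 u : @super_mul (-1) (assoc_dbl k) u (1%:M, 0) = 0.
  case: u => a b; rewrite super_assocE !(mul0mx, mulmx0, mul1mx, mulmx1).
  by rewrite !(scaleN1r, subrr, oppr0, addr0).
move=> /dec[c xE] /dec[d yE]; rewrite /lie_mul {1}xE {1}yE.
rewrite (@super_mul_linearl (-1) (assoc_dbl k)).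
by rewrite !(@super_mul_linearr (-1) (assoc_dbl k)) s1x sx1 s1x !(scaler0, add0r).
Qed.

End LieQ.

Definition lieQ (n : nat) : dblalg := lie_dbl n.+1.

End Doubles.

Variant Qtype := LieQ | JordanQ.

Definition Q (t : Qtype) (F : fieldType) (n : nat) : dblalg F :=
  match t with LieQ => lieQ F n | JordanQ => jordanQ F n end.

(* Gam as a family of subspaces of the even part, and \underline{Gam} as a    *)
(* family of subspaces of the odd part.                                       *)
Definition even_family (F : fieldType) (D : dblalg F) (G : groupType)
    (Gam : G -> {vspace dbl_space D}) : G -> {vspace dbl_super D} :=
  fun g => (embc (dbl_space D) false @: Gam g)%VS.

Definition underline (F : fieldType) (D : dblalg F) (G : groupType)
    (Gam : G -> {vspace dbl_space D}) : G -> {vspace dbl_super D} :=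
  fun g => (embc (dbl_space D) true @: Gam g)%VS.

(* Main.v *)
From HB Require Import structures.
Require Import Defs.
From mathcomp Require Import all_boot all_order all_algebra.
From mathcomp Require Import ring.
From Stdlib Require Import Classical.

(* An isomorphism between the two gradings restricts to an automorphism phi of
   the even part and to a phi-semilinear map psi of modules on the odd part. As
   phi^-1 psi is an endomorphism of the adjoint module, it is a scalar, so psi
   and phi have the same images on subspaces: each odd component sits both in
   degree g d^-1 and in degree g c^-1 of the grading Delta, whence c = d.

   Conversely an automorphism phi of the even part extends to Q as t phi on the
   odd part as soon as phi multiplies the product of odd elements by a nonzero
   scalar, t^2 being the inverse of this scalar. In the Jordan case phi is an
   automorphism or an antiautomorphism of M_n (Smiley's argument), and the
   scalar is 1 or -1. In the Lie case no description of phi is needed: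
   (a, b) |-> phi^-1 ((phi a phi b + phi b phi a)^sharp) is a symmetric
   equivariant map sl x sl -> sl, and a computation on matrix units shows that
   these maps are all proportional to (ab + ba)^sharp. *)

Set Implicit Arguments.
Unset Strict Implicit.
Unset Printing Implicit Defensive.

Import GRing.Theory.
Local Open Scope ring_scope.

(** * Commutators of matrix units *)

Definition lie (R : fieldType) k (a b : 'M[R]_k) := a *m b - b *m a.

Section MatrixUnits.
Variables (F : fieldType) (k : nat).
Implicit Types (a b x z : 'M[F]_k) (i j l p q r : 'I_k).
Local Notation e i j := (delta_mx i j : 'M[F]_k).

Lemma addmxE a b i j : (a + b) i j = a i j + b i j. Proof. by rewrite mxE. Qed.
Lemma oppmxE a i j : (- a) i j = - a i j. Proof. by rewrite mxE. Qed.
Lemma scalemxE c a i j : (c *: a) i j = c * a i j. Proof. by rewrite mxE. Qed.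
Lemma zeromxE i j : (0 : 'M[F]_k) i j = 0. Proof. by rewrite mxE. Qed.

Lemma lie_unitl i j z p q :
  lie (e i j) z p q = z j q *+ (p == i) - z p i *+ (q == j).
Proof.
rewrite /lie addmxE oppmxE !mxE; congr (_ - _).
  rewrite (bigD1 j) //= big1 => [|r /negPf rj]; rewrite mxE ?rj ?andbF ?mul0r //.
  by rewrite eqxx andbT addr0; case: eqP; rewrite (mul1r, mul0r).
rewrite (bigD1 i) //= big1 => [|r /negPf ri]; rewrite mxE ?ri ?mulr0 //.
by rewrite eqxx addr0; case: eqP; rewrite (mulr1, mulr0).
Qed.

Lemma lie_unit i j p q :
  lie (e i j) (e p q) = e i q *+ (j == p) - e p j *+ (q == i).
Proof. by rewrite /lie !mul_delta_mx_cond. Qed.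

Lemma lie_antisym a b : lie a b = - lie b a.
Proof. by rewrite /lie opprB. Qed.

Lemma lie_scalarl (c : F) b : lie c%:M b = 0.
Proof. by rewrite /lie mul_scalar_mx mul_mx_scalar subrr. Qed.

Lemma lie_linearr x : linear (lie x).
Proof.
move=> c u v; rewrite /lie mulmxDr mulmxDl -scalemxAr -scalemxAl scalerBr.
by rewrite opprD addrACA.
Qed.

Lemma mxtrace_lie a b : \tr (lie a b) = 0.
Proof. by rewrite /lie raddfB /= mxtrace_mulC subrr. Qed.

(** The entry [(i, o)] of [lie (e i o) z] is [z o o - z i i], and the entry [(i, i)] of
    [lie (e j i) z] is [- z i j]; their vanishing makes [z] scalar. *)
Lemma lie_units_scalar z :
  (forall i j, i != j -> lie (e i j) z = 0) -> exists c, z = c%:M.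
Proof.
move=> z_comm; case: (posnP k) => [k0|k_gt0].
  by exists 0; apply/matrixP=> i; have := ltn_ord i; rewrite [X in (_ < X)%N]k0.
pose o := Ordinal k_gt0; exists (z o o); apply/matrixP=> i j; rewrite mxE.
case: (eqVneq i j) => [<-|ij]; rewrite ?mulr1n.
  case: (eqVneq i o) => [->//|io].
  have := congr1 (fun m : 'M[F]_k => m i o) (z_comm i o io).
  by rewrite lie_unitl !eqxx !mulr1n mxE => /eqP; rewrite subr_eq0 => /eqP<-.
have ji : j != i by rewrite eq_sym.
have := congr1 (fun m : 'M[F]_k => m i i) (z_comm j i ji).
by rewrite lie_unitl eqxx (negPf ij) mulr0n mulr1n mxE sub0r => /eqP; rewrite oppr_eq0 => /eqP.
Qed.

Lemma scalar_tr0 z : k%:R != 0 :> F ->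
  (exists c, z = c%:M) -> \tr z = 0 -> z = 0.
Proof.
move=> k0 [c ->] /eqP; rewrite mxtrace_scalar -mulr_natr mulf_eq0 (negPf k0).
by rewrite orbF => /eqP->; rewrite raddf0.
Qed.

Lemma third_index i j : (2 < k)%N -> exists2 l, l != i & l != j.
Proof.
move=> k_gt2; case: (pickP [pred l | (l != i) && (l != j)]) => [l /andP[]|no].
  by exists l.
suff: (k <= 2)%N by rewrite leqNgt k_gt2.
rewrite -[k]card_ord -cardsT.
have <- : [set i; j] = setT.
  apply/setP=> l; rewrite !inE; have /= := no l.
  by case: eqP => //=; case: eqP.
by rewrite cards2; case: eqP.
Qed.

(** Swapping the two indices and moving the first one connect all off-diagonal positions; the case
    split only keeps the intermediate positions off the diagonal. *)
Lemma offdiag_constant (T : Type) (f : 'I_k -> 'I_k -> T) :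
    (forall i j, i != j -> f i j = f j i) ->
    (forall i j l, i != j -> i != l -> j != l -> f i l = f j l) ->
  forall i j p q, i != j -> p != q -> f i j = f p q.
Proof.
move=> fC fl; have fl' i j l : i != l -> j != l -> f i l = f j l.
  by case: (eqVneq i j) => [->//|ij il jl]; apply: fl.
move=> i l p q il pq; have li : l != i by rewrite eq_sym.
have qp : q != p by rewrite eq_sym.
case: (eqVneq p l) pq qp => [->|pl] pq qp.
  case: (eqVneq q i) => [->|qi]; first exact: fC.
  by rewrite fC // (fl' l q) // fC // (fl' i l q) // eq_sym.
by rewrite (fl' i p) // fC // (fl' l q) 1?eq_sym // fC.
Qed.

End MatrixUnits.

(** * Equivariant maps on matrices *)

(** The maps below are bare functions satisfying the predicate [linear], without a canonical linear
    structure, so the usual rules are collected here for rewriting. *)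
Lemma linear_spec (F : fieldType) (U V : lmodType F) (f : U -> V) : linear f ->
  [/\ f 0 = 0, {morph f : x y / x + y}, {morph f : x / - x},
      {morph f : x y / x - y} & forall c, {morph f : x / c *: x}].
Proof.
move=> f_lin; have fD : {morph f : x y / x + y}.
  by move=> x y; have := f_lin 1 x y; rewrite !scale1r.
have f0 : f 0 = 0 by apply: (addrI (f 0)); rewrite -fD !addr0.
have fZ c : {morph f : x / c *: x}.
  by move=> x; have := f_lin c x 0; rewrite f0 !addr0.
have fN : {morph f : x / - x} by move=> x; rewrite -scaleN1r fZ scaleN1r.
by split=> // x y; rewrite fD fN.
Qed.

Lemma matrix_linear_ext (F : fieldType) (V : lmodType F) k (f g : 'M[F]_k -> V) :
    linear f -> linear g ->
  (forall i j, f (delta_mx i j) = g (delta_mx i j)) -> f =1 g.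
Proof.
move=> /linear_spec[f0 fD _ _ fZ] /linear_spec[g0 gD _ _ gZ] fg x.
rewrite (matrix_sum_delta x) (big_morph f fD f0) (big_morph g gD g0).
apply: eq_bigr => i _; rewrite (big_morph f fD f0) (big_morph g gD g0).
by apply: eq_bigr => j _; rewrite fZ gZ fg.
Qed.

Ltac simp_units :=
  rewrite ?lie_unit ?eqxx;
  repeat match goal with
  | H : is_true (?i != ?j) |- context [?i == ?j] => rewrite (negPf H)
  | H : is_true (?i != ?j) |- context [?j == ?i] => rewrite [j == i]eq_sym (negPf H)
  end;
  rewrite ?mulr0n ?mulr1n ?subr0 ?sub0r ?addr0 ?add0r.

(** * The centroid of matrices under the commutator *)

Section LieCentroid.
Variables (F : fieldType) (k : nat) (T : 'M[F]_k -> 'M[F]_k).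
Hypotheses (two_neq0 : 2%:R != 0 :> F) (k_gt1 : (1 < k)%N).
Hypotheses (T_lin : linear T) (T_lie : forall a b, T (lie a b) = lie a (T b)).
Implicit Types (a b x z : 'M[F]_k) (i j l p q r : 'I_k).
Local Notation e i j := (delta_mx i j : 'M[F]_k).

(** Since [e i j] squares to zero, only the cross term [- 2 (e i j) x (e i j)] of the double
    commutator survives. *)
Lemma lie_sandwich i j x : i != j ->
  lie (e i j) (lie (e i j) x) = (- 2%:R * x j i) *: e i j.
Proof.
move=> ij; apply/matrixP=> p q; rewrite !lie_unitl !mxE.
have /negPf ji : j != i by rewrite eq_sym.
rewrite ?ji ?(negPf ij) ?eqxx ?mulr0n ?mulr1n.
by case: (p == i); case: (q == j); rewrite ?mulr1n ?mulr0n /=; ring.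
Qed.

(** The square of [ad (e i j)] has its image in the line of [e i j] and commutes with [T], so [T]
    multiplies each off-diagonal unit by a coefficient; brackets of units show the coefficients to
    be equal. A scalar summand remains, since commutators do not see it. *)
Lemma lie_centroid_scalar : exists t, forall x, exists c, T x = t *: x + c%:M.
Proof.
have [T0 TD TN TB TZ] := linear_spec T_lin.
have nz : - 2%:R != 0 :> F by rewrite oppr_eq0.
(* [T_sandwich] at [x = e j i] shows that this entry is the coefficient of [T] on [e i j]. *)
pose f i j := T (e j i) j i.
have T_sandwich i j x : i != j ->
    (- 2%:R * x j i) *: T (e i j) = (- 2%:R * T x j i) *: e i j.
  by move=> ij; rewrite -TZ -!lie_sandwich // !T_lie.
have Te i j : i != j -> T (e i j) = f i j *: e i j.
  move=> ij; have := T_sandwich i j (e j i) ij.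
  by rewrite mxE !eqxx -!scalerA scale1r => /(scalerI nz).
have fC i j : i != j -> f i j = f j i.
  by move=> ij; rewrite /f Te 1?eq_sym // scalemxE mxE !eqxx mulr1.
have fl i j l : i != j -> i != l -> j != l -> f i l = f j l.
  move=> ij il jl; have li : l != i by rewrite eq_sym.
  have eil : e i l = lie (e i j) (e j l).
    by rewrite lie_unit eqxx (negPf li) subr0.
  have := congr1 (fun m : 'M[F]_k => m i l) (Te i l il).
  by rewrite {1}eil T_lie Te // lie_unitl !scalemxE !mxE; simp_units; rewrite !mulr1.
pose o := Ordinal (ltnW k_gt1); pose o' := Ordinal k_gt1.
have f_const i j : i != j -> f i j = f o o'.
  by move=> ij; apply: offdiag_constant.
exists (f o o') => x; suff [c] : exists c, T x - f o o' *: x = c%:M.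
  by move=> E; exists c; rewrite -E addrC subrK.
(* Antisymmetry and equivariance move [T] from [x] to the unit, where it is known: [[e i j, T x] = -
   [x, T (e i j)]]. *)
apply: lie_units_scalar => i j ij.
have [_ _ _ lieB lieZ] := linear_spec (lie_linearr (e i j)).
rewrite lieB lieZ -T_lie lie_antisym TN T_lie Te // f_const //.
have [_ _ _ _ lieZ'] := linear_spec (lie_linearr x).
by rewrite lieZ' -scalerN -lie_antisym subrr.
Qed.
End LieCentroid.

#[local] Hint Extern 0 (is_true (_ != _)) => (rewrite eq_sym; assumption) : core.

(** * Symmetric equivariant products on matrices *)

Section EquivariantProduct.
Variables (F : fieldType) (k : nat) (be : 'M[F]_k -> 'M[F]_k -> 'M[F]_k).
Hypotheses (two_neq0 : 2%:R != 0 :> F) (k_neq0 : k%:R != 0 :> F).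
Hypothesis k_gt2 : (2 < k)%N.
Hypotheses (be_lin : forall a, linear (be a)) (beC : forall a b, be a b = be b a).
Hypothesis be_ad : forall x a b, lie x (be a b) = be (lie x a) b + be a (lie x b).
Hypotheses (be1 : forall b, be 1%:M b = 0) (be_tr : forall a b, \tr (be a b) = 0).
Implicit Types (a b x z : 'M[F]_k) (i j l p q r : 'I_k).
Local Notation e i j := (delta_mx i j : 'M[F]_k).

Let be0r a : be a 0 = 0. Proof. by case: (linear_spec (be_lin a)). Qed.
Let beDr a : {morph be a : x y / x + y}. Proof. by case: (linear_spec (be_lin a)). Qed.
Let beNr a : {morph be a : x / - x}. Proof. by case: (linear_spec (be_lin a)). Qed.
Let beBr a : {morph be a : x y / x - y}. Proof. by case: (linear_spec (be_lin a)). Qed.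
Let beZr a c : {morph be a : x / c *: x}. Proof. by case: (linear_spec (be_lin a)). Qed.
Let be0l a : be 0 a = 0. Proof. by rewrite beC be0r. Qed.
Let beNl a : {morph be^~ a : x / - x}.
Proof. by move=> x; rewrite !(beC _ a) beNr. Qed.
Let beBl a : {morph be^~ a : x y / x - y}.
Proof. by move=> x y; rewrite !(beC _ a) beBr. Qed.
Let beZl a c : {morph be^~ a : x / c *: x}.
Proof. by move=> x; rewrite !(beC _ a) beZr. Qed.

Lemma lie_diag_unit r i j :
  lie (e r r) (e i j) = ((r == i)%:R - (r == j)%:R) *: e i j.
Proof.
rewrite lie_unit [j == r]eq_sym scalerBl.
by case: eqP => [->|_]; case: eqP => [->|_]; rewrite ?scale1r ?scale0r.
Qed.

(** [ad (e r r)] multiplies the product by the sum of the weights of its factors, and its entry at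
    [(u, v)] by the weight of [e u v]. The equality holds in [F], where 2 is -1 in characteristic 3;
    the uses below therefore compare only weights 1 and -1. *)
Lemma be_unit_weight i j p q (u v : 'I_k) r : be (e i j) (e p q) u v != 0 ->
  (r == u)%:R - (r == v)%:R
    = (r == i)%:R - (r == j)%:R + ((r == p)%:R - (r == q)%:R) :> F.
Proof.
move=> nz; apply: (mulIf nz).
have := congr1 (fun m : 'M[F]_k => m u v) (be_ad (e r r) (e i j) (e p q)).
rewrite !lie_diag_unit beZl beZr -scalerDl scalemxE => <-.
rewrite lie_unitl ![_ == r]eq_sym mulrBl.
by case: eqP => [->|_]; case: eqP => [->|_]; rewrite ?mul1r ?mul0r.
Qed.

Let one_neqN1 : 1 != -1 :> F.
Proof. by rewrite -subr_eq0 opprK -(natrD _ 1 1). Qed.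

Let weight1 (s t : bool) : s%:R - t%:R = 1 :> F -> s.
Proof.
case: s => //; case: t => /=; rewrite sub0r => /eqP.
  by rewrite eq_sym (negPf one_neqN1).
by rewrite oppr0 eq_sym oner_eq0.
Qed.

Let weightN1 (s t : bool) : s%:R - t%:R = -1 :> F -> t.
Proof. by move=> E; apply: (@weight1 t s); rewrite -opprB E opprK. Qed.

Lemma be_same_row i j l : i != j -> i != l -> j != l -> be (e i j) (e i l) = 0.
Proof.
move=> ij il jl; apply/matrixP=> a b; rewrite [RHS]mxE; apply/eqP/negPn/negP => nz.
have := be_unit_weight j nz; have := be_unit_weight l nz.
simp_units => /weightN1/eqP lb /weightN1/eqP jb.
by rewrite lb jb eqxx in jl.
Qed.

(** The weight is 1 at both [i] and [p], but a unit has only one row. The case [j = q] of a common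
    column is included. *)
Lemma be_disjoint i j p q : i != j -> i != q -> p != j -> p != q -> i != p ->
  be (e i j) (e p q) = 0.
Proof.
move=> ij iq pj pq ip; apply/matrixP=> a b; rewrite [RHS]mxE; apply/eqP/negPn/negP => nz.
have := be_unit_weight i nz; have := be_unit_weight p nz.
simp_units => /weight1/eqP pa /weight1/eqP ia.
by rewrite pa ia eqxx in ip.
Qed.

(** In characteristic 3 weights alone would allow a multiple of [e j i]; instead [ad (e l j)] is
    applied to the zero product of [e i j] and [e i l], for a third index [l]. *)
Lemma be_square i j : i != j -> be (e i j) (e i j) = 0.
Proof.
move=> ij; have [l li lj] := third_index i j k_gt2.
have := be_ad (e l j) (e i j) (e i l); rewrite be_same_row //.
have [-> _ _ _ _] := linear_spec (lie_linearr (e l j)).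
by simp_units; rewrite be0l add0r beNr => /esym/eqP; rewrite oppr_eq0 => /eqP.
Qed.

(** Applying [ad (e j i)] to [be_square] gives twice the difference of the two sides. *)
Lemma be_unit_cartan i j : i != j -> be (e i j) (e i i) = be (e i j) (e j j).
Proof.
move=> ij; have := be_ad (e j i) (e i j) (e i j); rewrite be_square //.
have [-> _ _ _ _] := linear_spec (lie_linearr (e j i)).
simp_units; rewrite [X in X + _]beC -mulr2n => /esym/eqP.
rewrite -scaler_nat scaler_eq0 (negPf two_neq0) beBr subr_eq0.
by move=> /eqP.
Qed.

(** The structure constant of [be] on a path of length two. The lemmas below transport it between
    triples of distinct indices, so that [be] has essentially one constant. *)
Local Notation co i j l := (be (e i j) (e j l) i l).

Lemma be_path i j l : i != j -> j != l -> i != l ->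
  be (e i j) (e j l) = co i j l *: e i l.
Proof.
move=> ij jl il; apply/matrixP=> a b; rewrite [RHS]mxE mxE.
case: (eqVneq (be (e i j) (e j l) a b) 0) => [z0|nz]; last first.
  have := be_unit_weight i nz; have := be_unit_weight l nz.
  simp_units => /weightN1/eqP<- /weight1/eqP<-; by rewrite !eqxx mulr1.
rewrite z0; case: eqP => [ai|_]; last by rewrite mulr0.
by case: eqP => [bl|_]; rewrite ?mulr0 // -z0 ai bl mulr1.
Qed.

Lemma be_path_cartan i j l : i != j -> j != l -> i != l ->
  be (e i l) (e l j) = be (e i j) (e j j) - be (e i j) (e l l).
Proof.
move=> ij jl il; have := be_ad (e j l) (e i j) (e l j).
rewrite be_disjoint //.
have [-> _ _ _ _] := linear_spec (lie_linearr (e j l)).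
by simp_units; rewrite beNl beBr addrC => /esym/eqP; rewrite subr_eq0 => /eqP<-.
Qed.

(** [ad (e j i)] sends the path product to the product of [e j j - e i i] and [e j l], which the two
    lemmas on diagonal units identify with the product of [e j i] and [e i l]. *)
Lemma co_swap12 i j l : i != j -> j != l -> i != l -> co j i l = co i j l.
Proof.
move=> ij jl il; have := be_ad (e j i) (e i j) (e j l).
rewrite {1}be_path //; move: (co i j l) => c.
have [_ _ _ _ ->] := linear_spec (lie_linearr (e j i)).
simp_units; rewrite be0r addr0 beBl ![be _ (e j l)]beC be_unit_cartan // -be_path_cartan //.
move=> /(congr1 (fun m : 'M[F]_k => m j l)).
by rewrite scalemxE mxE !eqxx mulr1.
Qed.

Lemma be_opposite i j l : i != j -> j != l -> i != l ->
  be (e l j) (e j l) - be (e i j) (e j i) = co i j l *: (e l l - e i i).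
Proof.
move=> ij jl il; have := be_ad (e l i) (e i j) (e j l).
rewrite {1}be_path //; move: (co i j l) => c.
have [_ _ _ _ ->] := linear_spec (lie_linearr (e l i)).
by simp_units; rewrite beNr.
Qed.

(** Both sides of [be_opposite] change sign when [i] and [l] are exchanged, except for the
    constant. *)
Lemma co_swap13 i j l : i != j -> j != l -> i != l -> co l j i = co i j l.
Proof.
move=> ij jl il; have ji : j != i by rewrite eq_sym.
have lj : l != j by rewrite eq_sym.
have li : l != i by rewrite eq_sym.
have := be_opposite lj ji li; rewrite -opprB be_opposite //.
move=> /(congr1 (fun m : 'M[F]_k => m i i)).
by rewrite !mxE; simp_units; rewrite !mulrN1 opprK mulr1.
Qed.

Lemma co_start i j l p : i != j -> j != l -> i != l -> p != j -> p != l ->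
  co p j l = co i j l.
Proof.
move=> ij jl il pj pl; case: (eqVneq p i) => [->//|pi].
have := be_ad (e p i) (e i j) (e j l).
rewrite {1}be_path //; move: (co i j l) => c.
have [_ _ _ _ ->] := linear_spec (lie_linearr (e p i)).
simp_units; rewrite be0r addr0 => /(congr1 (fun m : 'M[F]_k => m p l)).
by rewrite scalemxE mxE !eqxx mulr1.
Qed.

(** * Vanishing of the product from one zero structure constant *)

Section Vanishing.
Variables i0 j0 l0 : 'I_k.
Hypotheses (i0j0 : i0 != j0) (j0l0 : j0 != l0) (i0l0 : i0 != l0).
Hypothesis co0 : co i0 j0 l0 = 0.

Lemma co_eq0 i j l : i != j -> j != l -> i != l -> co i j l = 0.
Proof.
have ex3 : exists j l, [/\ i != j, j != l, i != l & co i j l = 0].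
  case: (eqVneq i j0) => [->|ij]; first by exists i0, l0; rewrite co_swap12.
  case: (eqVneq i l0) => [->|il]; first by exists j0, i0; rewrite co_swap13.
  by exists j0, l0; rewrite (co_start i0j0).
have {ex3} ex2 : i != j -> exists l, [/\ i != j, j != l, i != l & co i j l = 0].
  move=> ij; have [p [q [ip pq iq c0]]] := ex3.
  case: (eqVneq j q) => [->|jq].
    exists p; split=> //; rewrite -(@co_swap12 i q p) // -(@co_swap13 q i p) //.
    by rewrite (@co_swap12 i p q).
  exists q; split=> //.
  by rewrite -(@co_swap12 i j q) // (@co_start p i q j) // (@co_swap12 i p q).
move=> ij jl il; have [q [_ jq iq c0]] := ex2 ij.
by rewrite -(@co_swap13 i j l) // (@co_start q j i l) // (@co_swap13 i j q).
Qed.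

Lemma be_path0 i j l : i != j -> j != l -> i != l -> be (e i j) (e j l) = 0.
Proof. by move=> ij jl il; rewrite be_path // co_eq0 // scale0r. Qed.

Lemma scalar1_sum_delta : 1%:M = \sum_i e i i.
Proof.
apply/matrixP=> a b; rewrite summxE mxE (bigD1 a) //= big1 => [|r ra].
  by rewrite mxE eqxx addr0 [b == a]eq_sym.
by rewrite mxE eq_sym (negPf ra).
Qed.

(* Since [be] kills the identity, it kills each [e r r] once these agree. *)
Lemma be_cartan_eq0 a : (forall r s, be a (e r r) = be a (e s s)) ->
  forall r, be a (e r r) = 0.
Proof.
move=> be_const r; have := be1 a; rewrite beC scalar1_sum_delta.
rewrite (big_morph _ (beDr a) (be0r a)) (eq_bigr (fun=> be a (e r r))) //.
by rewrite sumr_const card_ord -scaler_nat => /eqP; rewrite scaler_eq0 (negPf k_neq0) => /eqP.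
Qed.

Lemma be_unit_diag i j r : i != j -> be (e i j) (e r r) = 0.
Proof.
move=> ij; apply: be_cartan_eq0 => {r}.
suff E r : be (e i j) (e r r) = be (e i j) (e j j) by move=> r s; rewrite !E.
case: (eqVneq r j) => [->//|rj]; case: (eqVneq r i) => [->|ri]; first exact: be_unit_cartan.
by apply/esym/eqP; rewrite -subr_eq0 -be_path_cartan // be_path0.
Qed.

(** With zero constants [be_opposite] makes this product independent of the pair of indices. It then
    commutes with all off-diagonal units, so it is a scalar of trace zero. *)
Lemma be_unit_opposite i j : i != j -> be (e i j) (e j i) = 0.
Proof.
move=> ij; apply: (scalar_tr0 k_neq0); last exact: be_tr.
pose f i j := be (e i j) (e j i).
have fl p q r : p != q -> p != r -> q != r -> f p r = f q r.
  move=> pq pr qr; apply/eqP; rewrite eq_sym -subr_eq0 /f be_opposite //.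
  by rewrite co_eq0 ?scale0r.
apply: lie_units_scalar => p q pq; have [r rp rq] := third_index p q k_gt2.
(* The pair [(q, r)] is chosen so that [ad (e p q)] leaves only the path product of [e p r] and
   [e r q]. *)
rewrite -/(f i j) (@offdiag_constant k _ f _ _ _ _ q r) //; first 1 last.
- by move=> *; rewrite /f beC.
by rewrite be_ad; simp_units; rewrite be0r addr0 be_path0.
Qed.

Lemma be_diag_diag i j : be (e i i) (e j j) = 0.
Proof.
apply: be_cartan_eq0 => {j} p q; case: (eqVneq p q) => [->//|pq].
(* [[e q p, e p q] = e q q - e p p] produces the wanted difference; the other term is zero or, up to
   sign, a product of opposite units. *)
have := be_ad (e q p) (e i i) (e p q); rewrite [be (e i i) (e p q)]beC be_unit_diag //.
have [-> _ _ _ _] := linear_spec (lie_linearr (e q p)).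
have -> : be (lie (e q p) (e i i)) (e p q) = 0.
  rewrite lie_unit; case: eqP => [<-|_]; case: eqP => [iq|_];
    rewrite ?mulr0n ?subr0 ?sub0r ?be0l //.
  - by rewrite iq eqxx in pq.
  - by rewrite be_unit_opposite.
  - by rewrite iq beNl be_unit_opposite ?oppr0.
rewrite add0r; simp_units; rewrite beBr => /esym/eqP; rewrite subr_eq0 => /eqP.
by [].
Qed.

Lemma be_eq0 a b : be a b = 0.
Proof.
have zlin : linear (fun _ : 'M[F]_k => 0 : 'M[F]_k) by move=> c u v; rewrite scaler0 addr0.
apply: (@matrix_linear_ext F _ k (be a) (fun=> 0)) => // p q; rewrite beC.
apply: (@matrix_linear_ext F _ k (be _) (fun=> 0)) => // i j; rewrite beC.
case: (eqVneq i j) => [<-|ij]; case: (eqVneq p q) => [<-|pq].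
- exact: be_diag_diag.
- by rewrite beC be_unit_diag.
- exact: be_unit_diag.
case: (eqVneq j p) => [<-|jp] in pq *.
  case: (eqVneq i q) => [<-|iq] in pq *; first exact: be_unit_opposite.
  exact: be_path0.
case: (eqVneq i q) => [<-|iq] in pq *.
  by rewrite beC be_path0.
case: (eqVneq i p) => [<-|ip] in jp pq *; last exact: be_disjoint.
case: (eqVneq j q) => [<-|jq]; first exact: be_square.
exact: be_same_row.
Qed.

End Vanishing.
End EquivariantProduct.

Lemma lie_jordan_leibniz (F : fieldType) k (x a b : 'M[F]_k) :
  lie x (a *m b + b *m a)
    = (lie x a *m b + b *m lie x a) + (a *m lie x b + lie x b *m a).
Proof.
rewrite /lie !(mulmxDl, mulmxDr, mulmxBl, mulmxBr, mulmxN, mulNmx) !mulmxA.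
apply/matrixP=> i j; rewrite !(addmxE, oppmxE); ring.
Qed.

Lemma lie_sharp (F : fieldType) k (x a : 'M[F]_k) : lie x (sharp a) = sharp (lie x a).
Proof.
have [_ _ _ -> _] := linear_spec (lie_linearr x).
rewrite /sharp mxtrace_lie mulr0 raddf0 subr0.
by rewrite [lie _ _%:M]lie_antisym lie_scalarl oppr0 subr0.
Qed.

Lemma mxtrace_sharp (F : fieldType) k (a : 'M[F]_k) : k%:R != 0 :> F ->
  \tr (sharp a) = 0.
Proof. by move=> k0; apply/eqP; rewrite -mem_sl sharp_sl. Qed.

(* The product of odd elements of the Lie superalgebra, extended to all matrices
   so that scalar matrices are in its kernel. *)
Definition sharp_jordan (F : fieldType) k (a b : 'M[F]_k) : 'M[F]_k :=
  sharp (sharp a *m sharp b + sharp b *m sharp a).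

Section EquivariantUnique.
Variables (F : fieldType) (k : nat).
Hypotheses (two_neq0 : 2%:R != 0 :> F) (k_neq0 : k%:R != 0 :> F).
Hypothesis k_gt2 : (2 < k)%N.
Implicit Types (a b x : 'M[F]_k).

Lemma sharp1 : sharp 1%:M = 0 :> 'M[F]_k.
Proof. by rewrite /sharp mxtrace_scalar mulVf // subrr. Qed.

Lemma sharp_jordan_linear a : linear (sharp_jordan a).
Proof.
move=> c u v; rewrite /sharp_jordan -sharp_linear; congr sharp.
rewrite sharp_linear; move: (sharp a) (sharp u) (sharp v) => {}a {}u {}v.
by rewrite mulmxDr mulmxDl -scalemxAr -scalemxAl scalerDr addrACA.
Qed.

Lemma sharp_jordanC a b : sharp_jordan a b = sharp_jordan b a.
Proof. by rewrite /sharp_jordan addrC. Qed.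

Lemma sharp_jordan_ad x a b :
  lie x (sharp_jordan a b) = sharp_jordan (lie x a) b + sharp_jordan a (lie x b).
Proof.
have [_ shD _ _ _] := linear_spec (@sharp_linear F k).
by rewrite /sharp_jordan lie_sharp lie_jordan_leibniz shD !lie_sharp.
Qed.

Lemma sharp_jordan1 b : sharp_jordan 1%:M b = 0.
Proof.
have [sh0 _ _ _ _] := linear_spec (@sharp_linear F k).
by rewrite /sharp_jordan sharp1 mul0mx mulmx0 addr0 sh0.
Qed.

Lemma sharp_unit i j : i != j -> sharp (delta_mx i j) = delta_mx i j :> 'M[F]_k.
Proof.
move=> ij; rewrite /sharp /mxtrace big1 ?mulr0 ?raddf0 ?addr0 // => r _.
by rewrite mxE; case: eqP => //= ->; rewrite (negPf ij).
Qed.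

(** The structure constant of [sharp_jordan] at [(o0, o1, o2)] is 1. Subtracting [c] times it from
    [be], with [c] the constant of [be] there, leaves a product to which [be_eq0] applies. *)
Lemma equivariant_product_unique (be : 'M[F]_k -> 'M[F]_k -> 'M[F]_k) :
    (forall a, linear (be a)) -> (forall a b, be a b = be b a) ->
    (forall x a b, lie x (be a b) = be (lie x a) b + be a (lie x b)) ->
    (forall b, be 1%:M b = 0) -> (forall a b, \tr (be a b) = 0) ->
  exists c, forall a b, be a b = c *: sharp_jordan a b.
Proof.
move=> be_lin beC be_ad be1 be_tr.
pose o0 := Ordinal (ltnW (ltnW k_gt2)); pose o1 := Ordinal (ltnW k_gt2).
pose o2 := Ordinal k_gt2; pose e i j : 'M[F]_k := delta_mx i j.
exists (be (e o0 o1) (e o1 o2) o0 o2) => a b; set c := be _ _ _ _.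
apply/eqP; rewrite -subr_eq0; apply/eqP.
pose be' u v := be u v - c *: sharp_jordan u v.
have be'_lin u : linear (be' u).
  move=> d v w; rewrite /be' be_lin sharp_jordan_linear.
  move: (sharp_jordan u v) (sharp_jordan u w) => s s'.
  by rewrite scalerBr scalerDr !scalerA [d * c]mulrC opprD addrACA.
have be'C u v : be' u v = be' v u by rewrite /be' beC sharp_jordanC.
have be'_ad x u v : lie x (be' u v) = be' (lie x u) v + be' u (lie x v).
  rewrite /be'; have [_ _ _ -> lieZ] := linear_spec (lie_linearr x).
  rewrite lieZ be_ad sharp_jordan_ad.
  move: (sharp_jordan _ v) (sharp_jordan u _) => s s'.
  by rewrite scalerDr opprD addrACA.
have be'1 v : be' 1%:M v = 0 by rewrite /be' be1 sharp_jordan1 scaler0 subr0.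
have be'_tr u v : \tr (be' u v) = 0.
  by rewrite /be' raddfB /= be_tr linearZ /= mxtrace_sharp // mulr0 subr0.
apply: (be_eq0 two_neq0 k_neq0 k_gt2 be'_lin be'C be'_ad be'1 be'_tr
  (i0 := o0) (j0 := o1) (l0 := o2)); try exact: isT.
rewrite /be' addmxE oppmxE scalemxE /sharp_jordan !sharp_unit //.
rewrite !mul_delta_mx_cond eqxx addr0 sharp_unit // !mxE.
by rewrite !eqxx mulr1 subrr.
Qed.

End EquivariantUnique.

(** * Jordan homomorphisms of matrix algebras *)

(** A group is not the union of two proper subgroups: if [u] is outside [P], then for [x] in [P] the
    element [x - u] is outside [P], hence in [Q] together with [u], and so is [x]. *)
Lemma subgroup_union (V : zmodType) (P Q : V -> Prop) :
    (forall x y, P x -> P y -> P (x - y)) -> (forall x y, Q x -> Q y -> Q (x - y)) ->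
    (forall x, P x \/ Q x) ->
  (forall x, P x) \/ (forall x, Q x).
Proof.
move=> PB QB PQ; case: (classic (forall x, P x)) => [|/not_all_ex_not[u nPu]]; first by left.
right=> x; have Qu : Q u by case: (PQ u).
case: (PQ x) => // Px; case: (PQ (x - u)) => [Pxu|Qxu].
  by case: nPu; rewrite -[u](subKr x); apply: PB.
have Q0 : Q 0 by rewrite -(subrr u); exact: QB.
have QNu : Q (- u) by rewrite -[- u]add0r; exact: QB.
by rewrite -[x](subrK u) -[X in _ + X]opprK; exact: QB.
Qed.

Section JordanHom.
Variables (F : fieldType) (k : nat) (f : 'M[F]_k -> 'M[F]_k).
Hypothesis two_neq0 : 2%:R != 0 :> F.
Hypotheses (f_lin : linear f) (f_surj : forall y, exists x, f x = y).
Hypothesis f_jordan : forall a b, f (a *m b + b *m a) = f a *m f b + f b *m f a.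
Implicit Types (a b c x y z : 'M[F]_k).

Let f0 : f 0 = 0. Proof. by case: (linear_spec f_lin). Qed.
Let fD : {morph f : x y / x + y}. Proof. by case: (linear_spec f_lin). Qed.
Let fB : {morph f : x y / x - y}. Proof. by case: (linear_spec f_lin). Qed.
Let fZ (d : F) : {morph f : x / d *: x}. Proof. by case: (linear_spec f_lin). Qed.

(** The right side uses only the product [x y + y x], so Jordan homomorphisms preserve [a b a] once
    4 is cancelled. *)
Lemma jordan_quadratic a b : 4%:R *: (a *m b *m a) =
  2%:R *: (a *m (a *m b + b *m a) + (a *m b + b *m a) *m a)
  - ((a *m a + a *m a) *m b + b *m (a *m a + a *m a)).
Proof.
rewrite !(mulmxDl, mulmxDr) !mulmxA.
apply/matrixP=> i j; rewrite !(addmxE, oppmxE, scalemxE); ring.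
Qed.

Lemma jordan_hom_triple a b : f (a *m b *m a) = f a *m f b *m f a.
Proof.
have four_neq0 : 4%:R != 0 :> F by rewrite (natrM _ 2 2) mulf_neq0.
apply: (scalerI four_neq0); rewrite -fZ !jordan_quadratic fB fZ !f_jordan.
by [].
Qed.

Lemma jordan_hom_triple_sym a b c :
  f (a *m b *m c + c *m b *m a) = f a *m f b *m f c + f c *m f b *m f a.
Proof.
have pol x y z : x *m y *m z + z *m y *m x
    = (x + z) *m y *m (x + z) - x *m y *m x - z *m y *m z.
  rewrite !(mulmxDl, mulmxDr).
  by apply/matrixP=> i j; rewrite !(addmxE, oppmxE); ring.
by rewrite !pol !fB !jordan_hom_triple fD.
Qed.

Lemma sandwich_entry x y i j p q : (x *m delta_mx i j *m y) p q = x p i * y j q.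
Proof.
rewrite mxE (bigD1 j) //= big1 ?addr0 => [|r rj].
  rewrite mxE (bigD1 i) //= big1 ?addr0 => [|s si]; first by rewrite mxE !eqxx mulr1.
  by rewrite mxE (negPf si) mulr0.
rewrite mxE big1 ?mul0r // => s _.
by rewrite mxE (negPf rj) andbF mulr0.
Qed.

Lemma sandwich_skew_eq0 x y :
  (forall z, x *m z *m y + y *m z *m x = 0) -> x = 0 \/ y = 0.
Proof.
move=> skew; have E i j p q : x p i * y j q + y p i * x j q = 0.
  by rewrite -!sandwich_entry -addmxE skew mxE.
case: (pickP [pred u : 'I_k * 'I_k | x u.1 u.2 != 0]) => [[p i] /= xpi|x0]; last first.
  by left; apply/matrixP=> p i; rewrite mxE; apply/eqP/negbFE/(x0 (p, i)).
right.
(* At the position of a nonzero entry of [x] the identity reads [2 x_pi y_pi = 0]; the other entries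
   of [y] then follow from [x_pi y_jq = 0]. *)
have ypi : y p i = 0.
  have := E i p p i; rewrite [y p i * _]mulrC -mulr2n => /eqP.
  by rewrite -mulr_natr mulf_eq0 (negPf two_neq0) orbF mulf_eq0 (negPf xpi) => /eqP.
apply/matrixP=> j q; have := E i j p q; rewrite ypi mul0r addr0 mxE => /eqP.
by rewrite mulf_eq0 (negPf xpi) => /eqP.
Qed.

(* Smiley's argument: with [x := f (a b) - f a f b], [y := f (a b) - f b f a],
   expanding [f (ab r ba + ba r ab)] in two ways yields [x f(r) y + y f(r) x = 0]. *)
Lemma jordan_hom_pointwise a b :
  f (a *m b) = f a *m f b \/ f (a *m b) = f b *m f a.
Proof.
suff [/eqP|/eqP] : f (a *m b) - f a *m f b = 0 \/ f (a *m b) - f b *m f a = 0.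
- by rewrite subr_eq0 => /eqP; left.
- by rewrite subr_eq0 => /eqP; right.
apply: sandwich_skew_eq0 => z; have [r <-] := f_surj z.
have := jordan_hom_triple_sym (a *m b) r (b *m a).
have -> : f (b *m a) = f a *m f b + f b *m f a - f (a *m b).
  by rewrite -f_jordan fD addrC addKr.
have -> : a *m b *m r *m (b *m a) + b *m a *m r *m (a *m b)
    = a *m (b *m r *m b) *m a + b *m (a *m r *m a) *m b by rewrite !mulmxA.
rewrite fD !jordan_hom_triple !(mulmxDl, mulmxDr, mulmxBl, mulmxBr, mulNmx, mulmxN) !mulmxA.
move=> /matrixP E; apply/matrixP=> i j; have := E i j.
rewrite !(addmxE, oppmxE, zeromxE) => /eqP; rewrite -subr_eq0 => /eqP {}E.
by rewrite -[RHS]E; ring.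
Qed.

(** The alternative, known for each pair, is made uniform by [subgroup_union] twice: in [b] for
    fixed [a], then in [a]. *)
Lemma jordan_hom_or_antihom :
  (forall a b, f (a *m b) = f a *m f b) \/ (forall a b, f (a *m b) = f b *m f a).
Proof.
apply: subgroup_union.
- by move=> x y fx fy b; rewrite mulmxBl !fB mulmxBl fx fy.
- by move=> x y fx fy b; rewrite mulmxBl !fB mulmxBr fx fy.
move=> a; apply: subgroup_union.
- by move=> x y fx fy; rewrite mulmxBr !fB mulmxBr fx fy.
- by move=> x y fx fy; rewrite mulmxBr !fB mulmxBl fx fy.
exact: jordan_hom_pointwise.
Qed.

End JordanHom.

(** * The centroid of matrices under the Jordan product *)

Section JordanCentroid.
Variables (F : fieldType) (k : nat) (T : 'M[F]_k -> 'M[F]_k).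
Hypothesis two_neq0 : 2%:R != 0 :> F.
Hypothesis T_lin : linear T.
Hypothesis T_jordan : forall a b,
  T (a *m b + b *m a) = a *m T b + T b *m a.
Implicit Types (a b : 'M[F]_k).

Lemma jordan_centroid_scalar : exists t, forall x, T x = t *: x.
Proof.
have [_ TD _ _ _] := linear_spec T_lin.
have T1 a : T a + T a = a *m T 1%:M + T 1%:M *m a.
  by rewrite -TD -T_jordan mulmx1 mul1mx.
(* [T (a b + b a)] is symmetric in [a] and [b]; writing [T a] and [T b] through [T 1] by [T1] turns
   this symmetry into the commutation. *)
have comm a b : lie (lie a b) (T 1%:M) = 0.
  have : a *m (T b + T b) + (T b + T b) *m a = b *m (T a + T a) + (T a + T a) *m b.
    rewrite !(mulmxDr, mulmxDl) addrACA -T_jordan [RHS]addrACA -T_jordan.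
    by rewrite [b *m a + _]addrC.
  rewrite !T1 /lie !(mulmxDl, mulmxDr, mulmxBl, mulmxBr, mulNmx, mulmxN) !mulmxA.
  move=> /matrixP E; apply/matrixP=> i j; have := E i j.
  rewrite !(addmxE, oppmxE, zeromxE) => /eqP; rewrite -subr_eq0 => /eqP {}E.
  by rewrite -[RHS]E; ring.
have [t T1E] : exists t, T 1%:M = t%:M.
  (* An off-diagonal unit is itself a commutator, [[e i i, e i j]]. *)
  apply: lie_units_scalar => i j ij; rewrite -(comm (delta_mx i i) (delta_mx i j)).
  by rewrite lie_unit eqxx [j == i]eq_sym (negPf ij) subr0.
exists t => x; apply: (scalerI two_neq0).
by rewrite !scaler_nat !mulr2n T1 T1E mul_scalar_mx mul_mx_scalar.
Qed.

End JordanCentroid.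

(** * Gradings on doubled algebras *)

Lemma linear_lfun (F : fieldType) (U W : vectType F) (f : U -> W) :
  linear f -> exists phi : 'Hom(U, W), phi =1 f.
Proof.
move=> f_lin; pose fL := GRing.isLinear.Build F U W *:%R f f_lin.
pose f' : {linear U -> W} := HB.pack f fL.
by exists (linfun f') => x; rewrite lfunE.
Qed.

Lemma lker0_limg (F : fieldType) (U : vectType F) (phi : 'Hom(U, U)) :
  lker phi = 0%VS -> limg phi = fullv.
Proof.
move=> phi0; apply/eqP; rewrite eqEdim subvf /=.
by rewrite limg_dim_eq // phi0 capv0.
Qed.

Section DoubleGradings.
Variables (F : fieldType) (D : dblalg F) (G : groupType).
Local Notation V := (dbl_space D).
Implicit Types (Gam Del : G -> {vspace V}) (c d g : G).

Definition odd_mul (x y : V) : V := (dbl_mul (oddc x) (oddc y)).1.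

Lemma odd_mulE x y : evenc (odd_mul x y) = dbl_mul (oddc x) (oddc y).
Proof. exact: (@dbl_mul_part F D true true (oddc x) (oddc y)). Qed.

Definition double_family Gam c : G -> {vspace dbl_super D} :=
  oplus (even_family Gam) (shift (underline Gam) c).

Lemma mem_double_family Gam c g (x : V * V) :
  (x \in double_family Gam c g) = (x.1 \in Gam g) && (x.2 \in Gam (g * c^-1)%g).
Proof.
apply/memv_addP/andP => [[u /memv_imgP[a a_g ->] [v /memv_imgP[b b_g ->] ->]]|[x1 x2]].
  by rewrite !embcE /= addr0 add0r.
exists (evenc x.1); first by apply/memv_imgP; exists x.1; rewrite ?embcE.
exists (oddc x.2); first by apply/memv_imgP; exists x.2; rewrite ?embcE.
by rewrite -[LHS](partD x).
Qed.

Lemma decomposition_disjoint Gam g h : decomposition Gam -> g != h ->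
  (Gam g :&: Gam h = 0)%VS.
Proof.
move=> [dir _] gh; have := dir [:: g; h].
rewrite /= inE gh => /(_ isT).
rewrite directvE /= !(big_cons, big_nil) !addv0 addn0 => dim_gh.
by apply/directv_addP; rewrite directvE.
Qed.

Hypotheses
  (mul_eo : forall x y : V, dbl_mul (evenc x) (oddc y) = oddc (even_mul x y))
  (mul_oe : forall x y : V, dbl_mul (oddc x) (evenc y) = oddc (even_mul x y)).

Lemma dbl_mulE (x y : V * V) : dbl_mul x y =
  (even_mul x.1 y.1 + odd_mul x.2 y.2, even_mul x.1 y.2 + even_mul x.2 y.1).
Proof.
rewrite -{1}[x](partD x) -{1}[y](partD y).
have [_ mulD _ _ _] := linear_spec (@dbl_mul_linearr F D (part false x + part true x)).
have mulDl z := let: And5 _ H _ _ _ := linear_spec (@dbl_mul_linearl F D z) in H.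
rewrite mulD !mulDl -/(evenc x.1) -/(evenc y.1) -/(oddc x.2) -/(oddc y.2).
rewrite mul_eo mul_oe -even_mulE -odd_mulE.
by congr (_, _); rewrite /= ?add0r ?addr0 // addrC.
Qed.

Lemma extend_even_iso Gam Del c (phi : 'Hom(dbl_even D, dbl_even D)) (t : F) :
    t != 0 -> is_iso phi -> (forall g, phi @: Gam g = Del g)%VS ->
    (forall x y, phi (odd_mul x y) = t ^+ 2 *: odd_mul (phi x) (phi y)) ->
  isomorphic_gradings (dbl_super D) (dbl_super D)
    (double_family Gam c) (double_family Del c).
Proof.
move=> t0 [phi_inj phi_surj phi_mul _] phi_gr phi_odd.
have phi_mul' x y : phi (even_mul x y) = even_mul (phi x) (phi y) := phi_mul x y.
pose P (x : V * V) : V * V := (phi x.1, t *: phi x.2).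
have P_lin : linear P.
  by move=> a x y; rewrite /P /= !linearP.
have [Phi PhiE] := linear_lfun P_lin.
have odd_mulZ a b x y : odd_mul (a *: x) (b *: y) = (a * b) *: odd_mul x y.
  have oddZ s z : oddc (s *: z : V) = s *: oddc z by congr (_, _); rewrite /= ?scaler0.
  have [_ _ _ _ mulZ] := linear_spec (@dbl_mul_linearr F D (oddc (a *: x))).
  have [_ _ _ _ mulZl] := linear_spec (@dbl_mul_linearl F D (oddc y)).
  by rewrite /odd_mul [oddc (b *: y)]oddZ mulZ oddZ mulZl scalerA mulrC.
have even_mulZl a (x y : V) : even_mul (a *: x) y = a *: even_mul x y.
  by have [_ _ _ _ ->] := linear_spec (@even_mul_linearl F D y).
have even_mulZr a (x y : V) : even_mul x (a *: y) = a *: even_mul x y.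
  by have [_ _ _ _ ->] := linear_spec (@even_mul_linearr F D x).
have Phi_inj : lker Phi = 0%VS.
  apply/eqP; rewrite -subv0; apply/subvP=> -[x y]; rewrite memv_ker PhiE memv0.
  case/eqP=> /eqP + /eqP; rewrite scaler_eq0 (negPf t0) /= -!memv_ker phi_inj !memv0.
  by move=> /eqP-> /eqP->.
exists Phi; first split=> //.
- exact: lker0_limg.
- move=> x y; rewrite !PhiE /= !dbl_mulE /P /= odd_mulZ even_mulZl even_mulZr -scalerDr.
  by rewrite !linearD /= phi_odd !phi_mul'.
- move=> i; apply/subvP=> _ /memv_imgP[x + ->]; rewrite PhiE !mem_limg_embc.
  by move=> /eqP<-; rewrite /P; case: i => /=; rewrite !linear0 ?scaler0.
move=> g; apply/vspaceP=> y; rewrite mem_double_family -!phi_gr.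
apply/memv_imgP/andP => [[x + ->]|[/memv_imgP[a a_g y1] /memv_imgP[b b_g y2]]].
  rewrite mem_double_family PhiE => /andP[x1 x2]; split; first exact: memv_img.
  by rewrite memvZ // memv_img.
exists (a, t^-1 *: b); first by rewrite mem_double_family /= a_g memvZ.
by rewrite PhiE /P /= linearZ /= scalerA divff // scale1r -y1 -y2; case: (y).
Qed.

Hypothesis centroid : forall T : V -> V, linear T ->
  (forall x y, T (even_mul x y) = even_mul x (T y)) -> exists t, forall x, T x = t *: x.

Lemma restrict_double_iso Gam Del c d : (fullv : {vspace V}) <> 0%VS ->
    decomposition Del ->
    isomorphic_gradings (dbl_super D) (dbl_super D)
      (double_family Gam c) (double_family Del d) ->
  isomorphic_gradings (dbl_even D) (dbl_even D) Gam Del /\ c = d.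
Proof.
move=> V0 Del_dec [Phi [Phi_inj Phi_surj Phi_mul Phi_part] Phi_gr].
have PhiP i x : part i (Phi (part i x)) = Phi (part i x).
  apply/eqP; rewrite -mem_limg_embc; apply: (subvP (Phi_part i)).
  by apply: memv_img; rewrite mem_limg_embc; case: i.
pose f x := (Phi (evenc x)).1; pose h x := (Phi (oddc x)).2.
have Phie x : Phi (evenc x) = evenc (f x) by rewrite -(PhiP false (evenc x)).
have Phio x : Phi (oddc x) = oddc (h x) by rewrite -(PhiP true (oddc x)).
have PhiE x : Phi x = (f x.1, h x.2).
  rewrite -[x in LHS](partD x) linearD /= -/(evenc x.1) -/(oddc x.2) Phie Phio.
  by congr (_, _); rewrite /= (addr0, add0r).
have f_lin : linear f by move=> a x y; rewrite /f !linearP.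
have h_lin : linear h by move=> a x y; rewrite /h !linearP.
have [phi phiE] := linear_lfun f_lin; have [psi psiE] := linear_lfun h_lin.
have Phi0 x : Phi x = 0 -> x = 0.
  by move=> /eqP; rewrite -memv_ker Phi_inj memv0 => /eqP.
have phi_inj : lker phi = 0%VS.
  apply/eqP; rewrite -subv0; apply/subvP=> x; rewrite memv_ker phiE memv0 => /eqP fx.
  have /Phi0 : Phi (evenc x) = 0 by rewrite Phie fx.
  by case=> ->.
have comp g (x : V * V) : x \in double_family Gam c g -> Phi x \in double_family Del d g.
  by move=> x_g; rewrite -Phi_gr memv_img.
have comp' g (y : V * V) : y \in double_family Del d g ->
    exists2 x, x \in double_family Gam c g & y = Phi x.
  by rewrite -Phi_gr => /memv_imgP.
have phi_gr g : (phi @: Gam g = Del g)%VS.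
  apply/vspaceP=> y; apply/memv_imgP/idP => [[x x_g ->]|y_g].
    have := comp g (evenc x); rewrite !mem_double_family x_g mem0v => /(_ isT).
    by rewrite PhiE phiE => /andP[].
  have [|[a b]] := comp' g (evenc y); first by rewrite mem_double_family y_g mem0v.
  by rewrite mem_double_family PhiE => /andP[/= a_g _] [ya _]; exists a; rewrite // phiE.
have psi_gr g : (Del (g * d^-1)%g <= psi @: Gam (g * c^-1)%g)%VS.
  apply/subvP=> y y_g; apply/memv_imgP.
  have [|[a b]] := comp' g (oddc y); first by rewrite mem_double_family y_g mem0v.
  by rewrite mem_double_family PhiE => /andP[_ /= b_g] [_ yb]; exists b; rewrite // psiE.
have phi_mul x y : phi (even_mul x y) = even_mul (phi x) (phi y).
  have := Phi_mul (evenc x) (evenc y); rewrite /= -even_mulE !Phie -even_mulE.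
  by rewrite !phiE => -[].
have psi_mul x y : psi (even_mul x y) = even_mul (phi x) (psi y).
  have := Phi_mul (evenc x) (oddc y); rewrite /= mul_eo Phie !Phio mul_eo.
  by rewrite phiE !psiE => -[].
split.
  exists phi => //; split=> //; first exact: lker0_limg.
  case=> /=; last exact: subvf.
  by rewrite limg0.
have phiK := lker0_lfunK (introT eqP phi_inj).
have phiVK y : phi ((phi^-1)%VF y) = y.
  by apply: limg_lfunVK; rewrite lker0_limg ?memvf.
pose T x := (phi^-1)%VF (psi x).
have T_lin : linear T by move=> a x y; rewrite /T !linearP.
have [|t TE] := centroid T_lin.
  by move=> x y; rewrite /T psi_mul -[in LHS](phiVK (psi y)) -phi_mul phiK.
have psi_scal x : psi x = t *: phi x by rewrite -[LHS]phiVK -/(T x) TE linearZ.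
case: (eqVneq c d) => // cd; case: V0.
have Del0 g : Del g = 0%VS.
  (* In degree [k] of the double grading, [Del g] lies in the [psi]-image of [Gam (k c^-1)], hence
     in [Del (k c^-1)]. For [c] different from [d] this component has another degree and meets
     [Del g] in zero. *)
  pose k := (g * d)%g; have gE : (k * d^-1)%g = g by rewrite /k -mulgA mulgV mulg1.
  apply/eqP; rewrite -subv0 -(@decomposition_disjoint Del (k * d^-1) (k * c^-1))%g //; last first.
    by apply: contra_neq cd => /(can_inj (mulKg k))/invg_inj.
  rewrite subv_cap gE subvv -{1}gE (subv_trans (psi_gr k)) //.
  apply/subvP=> _ /memv_imgP[x x_g ->]; rewrite psi_scal memvZ // -phi_gr.
  exact: memv_img.
have [_ [s _ <-]] := Del_dec; rewrite big1 // => g _; exact: Del0.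
Qed.

Hypothesis even_iso_odd : forall phi : 'Hom(dbl_even D, dbl_even D), is_iso phi ->
  exists2 t, t != 0 & forall x y, phi (odd_mul x y) = t ^+ 2 *: odd_mul (phi x) (phi y).

Lemma double_gradings_isomorphic Gam Del c d : (fullv : {vspace V}) <> 0%VS ->
    decomposition Del ->
  isomorphic_gradings (dbl_super D) (dbl_super D)
    (double_family Gam c) (double_family Del d) <->
  isomorphic_gradings (dbl_even D) (dbl_even D) Gam Del /\ c = d.
Proof.
move=> V0 Del_dec; split=> [|[[phi phi_iso phi_gr] <-]]; first exact: restrict_double_iso.
have [t t0 phi_odd] := even_iso_odd phi_iso.
exact: extend_even_iso t0 phi_iso phi_gr phi_odd.
Qed.

End DoubleGradings.

(** * The superalgebras Q(n) *)

Lemma closed_field_sqrt (F : closedFieldType) (u : F) : exists t, t ^+ 2 = u.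
Proof.
(* The function lists the lower coefficients: the root satisfies [t ^+ 2 = u + 0 * t]. *)
have [t tE] := @solve_monicpoly F 2 (fun i => if i is 0 then u else 0) isT.
by exists t; rewrite tE !big_ord_recl big_ord0 /= mulr1 mul0r !addr0.
Qed.

Lemma fullv_neq0 (F : fieldType) (V : vectType F) (x : V) :
  x != 0 -> (fullv : {vspace V}) <> 0%VS.
Proof. by move=> /eqP x0 V0; apply/x0/eqP; rewrite -memv0 -V0 memvf. Qed.

(** * The Jordan case *)

Section JordanQ.
Variables (F : closedFieldType) (n : nat).
Hypothesis two_neq0 : 2%:R != 0 :> F.
Implicit Types a b : 'M[F]_n.

Lemma jordanQ_even_mulE a b : even_mul (D := jordanQ F n) a b = a *m b + b *m a.
Proof. by rewrite /even_mul jordanQE /= mulmx0 subr0 addr0. Qed.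

Lemma jordanQ_odd_mulE a b : odd_mul (D := jordanQ F n) a b = a *m b - b *m a.
Proof. by rewrite /odd_mul jordanQE /= mulmx0 !add0r. Qed.

Lemma jordanQ_even_odd a b : @dbl_mul F (jordanQ F n) (evenc a) (oddc b)
  = oddc (even_mul (D := jordanQ F n) a b).
Proof.
by rewrite jordanQ_even_mulE jordanQE !(mul0mx, mulmx0) !(add0r, addr0, oppr0).
Qed.

Lemma jordanQ_odd_even a b : @dbl_mul F (jordanQ F n) (oddc a) (evenc b)
  = oddc (even_mul (D := jordanQ F n) a b).
Proof.
by rewrite jordanQ_even_mulE jordanQE !(mul0mx, mulmx0) !(add0r, addr0, oppr0).
Qed.

Lemma jordanQ_centroid (T : 'M[F]_n -> 'M[F]_n) : linear T ->
  (forall x y, T (even_mul (D := jordanQ F n) x y) = even_mul (D := jordanQ F n) x (T y)) ->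
  exists t, forall x, T x = t *: x.
Proof.
move=> T_lin T_mul; apply: jordan_centroid_scalar => // a b.
by have := T_mul a b; rewrite !jordanQ_even_mulE.
Qed.

Lemma jordanQ_even_iso_odd (phi : 'Hom(dbl_even (jordanQ F n), dbl_even (jordanQ F n))) :
    is_iso phi ->
  exists2 t, t != 0 & forall a b,
    phi (odd_mul (D := jordanQ F n) a b) = t ^+ 2 *: odd_mul (D := jordanQ F n) (phi a) (phi b).
Proof.
case=> phi_inj phi_surj phi_mul _.
pose f : 'M[F]_n -> 'M[F]_n := phi.
have f_lin : linear f by move=> c a b; rewrite /f linearP.
have f_surj y : exists x, f x = y.
  by have /memv_imgP[x _ ->] : y \in limg phi; [rewrite phi_surj memvf | exists x].
have f_jordan a b : f (a *m b + b *m a) = f a *m f b + f b *m f a.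
  by have := phi_mul a b; rewrite /= !jordanQ_even_mulE.
have [_ _ _ fB _] := linear_spec f_lin.
have [f_mul|f_mul] := jordan_hom_or_antihom two_neq0 f_lin f_surj f_jordan.
  exists 1 => [|a b]; first exact: oner_neq0.
  by rewrite expr1n scale1r !jordanQ_odd_mulE -/f fB !f_mul.
(* An antiautomorphism reverses the sign of commutators, which [t ^+ 2 = -1] compensates. *)
have [t t2] := closed_field_sqrt (-1 : F).
exists t => [|a b].
  by apply: contra_eq_neq t2 => ->; rewrite expr0n /= eq_sym oppr_eq0 oner_eq0.
by rewrite t2 scaleN1r !jordanQ_odd_mulE -/f fB !f_mul opprB.
Qed.

End JordanQ.

(** * The Lie case *)

Section LieQ.
Variables (F : closedFieldType) (n : nat).
Local Notation k := n.+1.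
Local Notation L := (subvs_of (sl F k)).
Local Notation D := (lieQ F n).
Hypotheses (two_neq0 : 2%:R != 0 :> F) (k_neq0 : k%:R != 0 :> F).
Implicit Types (x y z : L) (a b : 'M[F]_k).

(** The projection along the scalar matrices. It extends maps on [sl] to all matrices, where the
    diagonal units, which are not traceless, are available. *)
Definition to_sl a : L := vsproj (sl F k) (sharp a).

Lemma val_to_sl a : vsval (to_sl a) = sharp a.
Proof. by rewrite vsprojK // sharp_sl. Qed.

Lemma to_slK x : to_sl (vsval x) = x.
Proof. by apply: subvs_inj; rewrite val_to_sl sharp_id // subvsP. Qed.

Lemma lie_sharpl a b : lie (sharp a) b = lie a b.
Proof.
rewrite [LHS]lie_antisym /sharp; have [_ _ _ -> _] := linear_spec (lie_linearr b).
by rewrite [lie b _%:M]lie_antisym lie_scalarl oppr0 subr0 -lie_antisym.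
Qed.

Lemma lieQ_mulE (u v : L * L) : @dbl_mul F D u v =
  (to_sl (lie (vsval u.1) (vsval v.1) + (vsval u.2 *m vsval v.2 + vsval v.2 *m vsval u.2)),
   to_sl (lie (vsval u.1) (vsval v.2) + lie (vsval u.2) (vsval v.1))).
Proof.
have [_ shD _ _ _] := linear_spec (@sharp_linear F k).
have tr0 a b : sharp (lie a b) = lie a b.
  by rewrite sharp_id // mem_sl mxtrace_lie.
apply: (can_inj (@subQK F k)); rewrite /= lie_mulE //.
by rewrite /subQ /= !val_to_sl; congr (_, _); rewrite [RHS]shD !tr0.
Qed.

Lemma to_sl_scalar (c : F) : to_sl c%:M = 0.
Proof.
apply: subvs_inj; rewrite val_to_sl /sharp mxtrace_scalar -[c *+ k]mulr_natr mulrCA mulVf //.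
by rewrite mulr1 subrr linear0.
Qed.

Lemma lieQ_even_mulE x y : even_mul (D := D) x y = to_sl (lie (vsval x) (vsval y)).
Proof. by rewrite /even_mul lieQ_mulE /= !linear0 !addr0. Qed.

Lemma lieQ_odd_mulE x y :
  odd_mul (D := D) x y = to_sl (vsval x *m vsval y + vsval y *m vsval x).
Proof. by rewrite /odd_mul lieQ_mulE /= /lie mulmx0 subr0 add0r. Qed.

Lemma lieQ_even_odd x y : @dbl_mul F D (evenc x) (oddc y) = oddc (even_mul (D := D) x y).
Proof.
rewrite lieQ_even_mulE lieQ_mulE /= /lie !(linear0, mulmx0, mul0mx, addr0, subr0).
by rewrite /to_sl /sharp !linear0 mulr0 raddf0 subr0 linear0.
Qed.

Lemma lieQ_odd_even x y : @dbl_mul F D (oddc x) (evenc y) = oddc (even_mul (D := D) x y).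
Proof.
rewrite lieQ_even_mulE lieQ_mulE /= /lie !(linear0, mulmx0, mul0mx, addr0, subr0, add0r).
by rewrite /to_sl /sharp !linear0 mulr0 raddf0 subr0 linear0.
Qed.

Lemma val_even_mul x y : vsval (even_mul (D := D) x y) = lie (vsval x) (vsval y).
Proof. by rewrite lieQ_even_mulE val_to_sl sharp_id // mem_sl mxtrace_lie. Qed.

Lemma val_odd_mul x y : vsval (odd_mul (D := D) x y) = sharp_jordan (vsval x) (vsval y).
Proof. by rewrite lieQ_odd_mulE val_to_sl /sharp_jordan !(sharp_id (subvsP _)). Qed.

Lemma to_sl_lie a b : to_sl (lie a b) = even_mul (D := D) (to_sl a) (to_sl b).
Proof.
rewrite lieQ_even_mulE !val_to_sl lie_sharpl.
by rewrite [lie a (sharp b)]lie_antisym lie_sharpl -lie_antisym.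
Qed.

Lemma to_sl_linear : linear to_sl.
Proof. by move=> c a b; rewrite /to_sl sharp_linear linearP. Qed.

Hypothesis n_ge2 : (2 <= n)%N.

Lemma lieQ_centroid (T : L -> L) : linear T ->
    (forall x y, T (even_mul (D := D) x y) = even_mul (D := D) x (T y)) ->
  exists t, forall x, T x = t *: x.
Proof.
move=> T_lin T_mul; pose T' a := vsval (T (to_sl a)).
have T'_lin : linear T' by move=> c a b; rewrite /T' to_sl_linear T_lin linearP.
have T'_lie a b : T' (lie a b) = lie a (T' b).
  by rewrite /T' to_sl_lie T_mul val_even_mul val_to_sl lie_sharpl.
have [t T'E] := lie_centroid_scalar two_neq0 (leqW n_ge2) T'_lin T'_lie.
exists t => x; apply: subvs_inj; rewrite -{1}[x]to_slK -/(T' (vsval x)).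
have [c Tx] := T'E (vsval x).
(* The scalar summand left by [lie_centroid_scalar] is a difference of traceless matrices. *)
suff c0 : c%:M = 0 :> 'M[F]_k by rewrite Tx c0 addr0 linearZ.
apply: (scalar_tr0 k_neq0); first by exists c.
have /eqP : \tr (T' (vsval x)) == 0 by rewrite -mem_sl subvsP.
rewrite Tx raddfD /= mxtraceZ.
by have := subvsP x; rewrite mem_sl => /eqP->; rewrite mulr0 add0r.
Qed.

Lemma lieQ_ad_odd x y z : even_mul (D := D) x (odd_mul (D := D) y z)
  = odd_mul (D := D) (even_mul (D := D) x y) z + odd_mul (D := D) y (even_mul (D := D) x z).
Proof.
apply: subvs_inj; rewrite val_even_mul val_odd_mul sharp_jordan_ad.
by rewrite -!val_even_mul -!val_odd_mul -linearD.
Qed.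

(** The units at [(0, 1)] and [(1, 2)] have the unit at [(0, 2)] as product. This makes the constant
    in [lieQ_even_iso_odd] nonzero, and [sl] nonzero as well. *)
Lemma lieQ_odd_mul_neq0 : exists x y, odd_mul (D := D) x y != 0.
Proof.
pose o0 : 'I_k := Ordinal (ltnW (ltnW (n_ge2 : (2 < k)%N))).
pose o1 : 'I_k := Ordinal (ltnW (n_ge2 : (2 < k)%N)).
pose o2 : 'I_k := Ordinal (n_ge2 : (2 < k)%N).
exists (to_sl (delta_mx o0 o1)), (to_sl (delta_mx o1 o2)).
apply/eqP => /(congr1 vsval); rewrite val_odd_mul !val_to_sl /sharp_jordan.
rewrite !sharp_unit // !mul_delta_mx_cond eqxx addr0 sharp_unit //.
move=> /(congr1 (fun m : 'M[F]_k => m o0 o2)); rewrite linear0 !mxE !eqxx.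
by apply/eqP; rewrite oner_neq0.
Qed.

Lemma lieQ_even_iso_odd (phi : 'Hom(dbl_even D, dbl_even D)) : is_iso phi ->
  exists2 t, t != 0 & forall x y,
    phi (odd_mul (D := D) x y) = t ^+ 2 *: odd_mul (D := D) (phi x) (phi y).
Proof.
case=> phi_inj phi_surj phi_mul _.
pose f : L -> L := phi; pose g : L -> L := (phi^-1)%VF.
have fK : cancel f g by apply: lker0_lfunK; apply/eqP.
have gK : cancel g f by move=> y; apply: limg_lfunVK; rewrite phi_surj memvf.
have f_lin : linear f by move=> c x y; rewrite /f linearP.
have g_lin : linear g by move=> c x y; rewrite /g linearP.
have [_ _ _ _ fZ] := linear_spec f_lin; have [g0 gD _ _ _] := linear_spec g_lin.
have f_mul x y : f (even_mul (D := D) x y) = even_mul (D := D) (f x) (f y) := phi_mul x y.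
have g_mul x y : even_mul (D := D) x (g y) = g (even_mul (D := D) (f x) y).
  by rewrite -[LHS]fK f_mul gK.
have odd_mulC x y : odd_mul (D := D) x y = odd_mul (D := D) y x.
  by rewrite (lieQ_odd_mulE x y) (lieQ_odd_mulE y x) addrC.
have odd_lin x : linear (odd_mul (D := D) x).
  move=> c y z; apply: subvs_inj; rewrite val_odd_mul linearP sharp_jordan_linear.
  by rewrite -(val_odd_mul x y) -(val_odd_mul x z) -linearP.
(* The odd product pulled back along [phi] and extended to all matrices by zero on scalars; [g_mul]
   makes it equivariant. *)
pose be a b := vsval (g (odd_mul (D := D) (f (to_sl a)) (f (to_sl b)))).
have be_lin a : linear (be a).
  by move=> c b b'; rewrite /be to_sl_linear f_lin odd_lin g_lin linearP.
have be_ad a b c : lie a (be b c) = be (lie a b) c + be b (lie a c).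
  rewrite /be -lie_sharpl -val_to_sl -val_even_mul g_mul lieQ_ad_odd gD linearD /=.
  by rewrite -!f_mul -!to_sl_lie.
have be1 b : be 1%:M b = 0.
  have [f0 _ _ _ _] := linear_spec f_lin.
  rewrite /be to_sl_scalar f0 odd_mulC.
  by have [-> _ _ _ _] := linear_spec (odd_lin (f (to_sl b))); rewrite g0 linear0.
have be_tr a b : \tr (be a b) = 0 by apply/eqP; rewrite -mem_sl subvsP.
have beC a b : be a b = be b a by rewrite /be odd_mulC.
have [c beE] := equivariant_product_unique two_neq0 k_neq0 n_ge2 be_lin beC be_ad be1 be_tr.
have odd_f x y : odd_mul (D := D) (f x) (f y) = c *: f (odd_mul (D := D) x y).
  rewrite -fZ -[LHS]gK; congr f; apply: subvs_inj; rewrite linearZ /= val_odd_mul -beE.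
  by rewrite /be !to_slK.
(* As [f] is onto, [c = 0] would make every product of odd elements vanish. *)
have c_neq0 : c != 0.
  have [x [y]] := lieQ_odd_mul_neq0; apply: contraNneq => c0.
  by rewrite -[x]gK -[y]gK odd_f c0 scale0r.
have [t t2] := closed_field_sqrt c^-1.
exists t => [|x y]; last by rewrite t2 odd_f scalerA mulVf // scale1r.
by apply: contra_eq_neq t2 => ->; rewrite expr0n /= eq_sym invr_eq0.
Qed.

End LieQ.

Theorem theorem5p4 (F : closedFieldType) (n : nat) (t : Qtype) (G : groupType)
    (Gam Del : G -> {vspace dbl_space (Q t F n)}) (c d : G)
    (charF2 : 2%N \notin [pchar F]%R)
    (n_ge2 : (2 <= n)%N)
    (charF_Lie : t = LieQ -> forall p : nat, p \in [pchar F]%R -> ~~ (p %| n.+1)%N)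
    (G_abelian : forall g h : G, (g * h)%g = (h * g)%g)
    (Gam_grading : is_grading (dbl_even (Q t F n)) Gam)
    (Del_grading : is_grading (dbl_even (Q t F n)) Del)
    (GamQ_grading : is_grading (dbl_super (Q t F n))
       (oplus (even_family Gam) (shift (underline Gam) c)))
    (DelQ_grading : is_grading (dbl_super (Q t F n))
       (oplus (even_family Del) (shift (underline Del) d))) :
  isomorphic_gradings (dbl_super (Q t F n)) (dbl_super (Q t F n))
    (oplus (even_family Gam) (shift (underline Gam) c))
    (oplus (even_family Del) (shift (underline Del) d))
  <->
  isomorphic_gradings (dbl_even (Q t F n)) (dbl_even (Q t F n)) Gam Del
  /\ c = d.
Proof.
have two_neq0 : 2%:R != 0 :> F by rewrite inE /= in charF2.
have [Del_dec _ _] := Del_grading.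
clear G_abelian Gam_grading Del_grading GamQ_grading DelQ_grading.
case: t => /= in Gam Del charF_Lie Del_dec *.
  have k_neq0 : n.+1%:R != 0 :> F.
    (* If [n + 1] were zero in [F], the characteristic would be a prime dividing it. *)
    apply/negP => k0; have [p p_char] := natf0_pchar (isT : (0 < n.+1)%N) k0.
    by have := charF_Lie erefl p p_char; rewrite (dvdn_pcharf p_char) k0.
  apply: double_gradings_isomorphic => //.
  - exact: lieQ_even_odd.
  - exact: lieQ_odd_even.
  - exact: lieQ_centroid.
  - exact: lieQ_even_iso_odd.
  - by have [x [y /fullv_neq0]] := lieQ_odd_mul_neq0 k_neq0 n_ge2.
apply: double_gradings_isomorphic => //.
- exact: jordanQ_even_odd.
- exact: jordanQ_odd_even.
- exact: jordanQ_centroid.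
- exact: jordanQ_even_iso_odd.
- have n_gt0 := ltnW n_ge2.
  apply: (@fullv_neq0 F _ (1%:M : 'M[F]_n)).
  apply/eqP=> /matrixP/(_ (Ordinal n_gt0) (Ordinal n_gt0))/eqP.
  by rewrite !mxE eqxx oner_eq0.
Qed.
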